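(* Let $(X,d_X)$ be a metric space. For $d\in\mathcal M(X)$ let $F(d)$ be the function $x\mapsto d(x,x')$ on $X$. The maps $$F^q:E(M^q(X))\to C_m^q(X),\qquad F^c:E(M^c(X))\to C_m^c(X)$$ induced by $d\mapsto F(d)$ on quasi-equivalence classes and on coarse equivalence classes, respectively, are bijections.
   Context: Let $(X,d_X)$ be a metric space. Write $X'$ for the second copy of $X$ in $X\times\{0,1\}$, $x$ for $(x,0)$ and $x'$ for $(x,1)$. $\mathcal M(X)$ is the set of all metrics $d$ on $X\times\{0,1\}$ whose restriction to each copy of $X$ equals $d_X$ and for which the distance between the two copies, $\inf_{x,y\in X}d(x,y')$, is non-zero. Two metrics $d_1,d_2\in\mathcal M(X)$ are quasi-equivalent ($d_1\sim_q d_2$) if there exist $\alpha>0,\beta\ge1$ with $-\alpha+\frac1\beta d_1(x,y')\le d_2(x,y')\le\alpha+\beta d_1(x,y')$ for all $x,y\in X$; they are coarse equivalent ($d_1\sim_c d_2$) if there exist monotone functions $\varphi,\psi:[0,\infty)\to[0,\infty)$ with $\lim_{t\to\infty}\varphi(t)=\lim_{t\to\infty}\psi(t)=\infty$ and $\varphi(d_1(x,y'))\le d_2(x,y')\le\psi(d_1(x,y'))$ for all $x,y\in X$. $M^q(X)$, $M^c(X)$ are the sets of classes; both are inverse semigroups under $[\rho][d]=[\rho d]$, where $(\rho d)(x,y')=\inf_{z\in X}[d(x,z')+\rho(z,y')]$. $E(S)$ denotes the set of idempotents of $S$; every idempotent class here is selfadjoint, i.e. contains a $d$ with $d(x,y')=d(y,x')$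 for all $x,y$. $\mathcal C_m(X)$ is the set of continuous functions $f:X\to[0,\infty)$ such that (f1) there is $\varepsilon>0$ with $f(x)\ge\varepsilon$ for all $x\in X$; (f2) $|f(x)-f(y)|\le 2d_X(x,y)$ for all $x,y\in X$. Positive functions $f,g$ on $X$ are quasi-equivalent if there exist $\alpha>0,\beta\ge1$ with $-\alpha+\frac1\beta f(x)\le g(x)\le\alpha+\beta f(x)$ for all $x$, and coarse equivalent if there exist monotone $\varphi,\psi:[0,\infty)\to[0,\infty)$ tending to $\infty$ at $\infty$ with $\varphi(f(x))\le g(x)\le\psi(f(x))$ for all $x$. $C_m^q(X)$, $C_m^c(X)$ are the sets of quasi-equivalence, resp. coarse equivalence, classes of $\mathcal C_m(X)$. *)

(* Defs.v *)
From HB Require Import structures.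
From mathcomp Require Import all_boot all_order all_algebra.
From mathcomp Require Import lra.
From mathcomp Require Import all_classical all_reals all_analysis.

Set Implicit Arguments.
Unset Strict Implicit.
Unset Printing Implicit Defensive.

Import Order.TTheory GRing.Theory Num.Theory.
Import numFieldNormedType.Exports.

Local Open Scope classical_set_scope.
Local Open Scope ring_scope.
Local Open Scope quotient_scope.

(* Infima of families of nonnegative reals. *)
Section Inf.
Context {R : realType} {T : Type}.
Implicit Types (h : T -> R) (z : T) (c : R).

Lemma inf_range_le h z : (forall t, 0 <= h t) -> inf (range h) <= h z.
Proof.
move=> h0; apply: ge_inf; last by exists z.
by exists 0 => _ [t _ <-].
Qed.

Lemma le_inf_range h z c : (forall t, c <= h t) -> c <= inf (range h).
Proof.
move=> ch; apply: lb_le_inf; first by exists (h z), z.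
by move=> _ [t _ <-].
Qed.

Lemma inf_range_adherent h z (e : R) : (forall t, 0 <= h t) -> 0 < e ->
  exists t, h t < inf (range h) + e.
Proof.
move=> h0 e0; have hi : has_inf (range h).
  by split; [exists (h z), z | exists 0 => _ [t _ <-]].
by have [_ [t _ <-] ht] := inf_adherent e0 hi; exists t.
Qed.

End Inf.

Section Equivalences.
Context {R : realType} {T : Type}.
Implicit Types f g h : T -> R.

Definition quasi_equiv f g : Prop :=
  exists a b : R, [/\ 0 < a, 1 <= b &
    forall t, - a + b^-1 * f t <= g t <= a + b * f t].

(* A function [0, oo) -> [0, oo) is represented by a function on R whose values
   at negative arguments are irrelevant.  A monotone function tending to +oo
   at +oo is necessarily nondecreasing. *)
Definition coarse_control (phi : R -> R) : Prop :=
  [/\ forall t, 0 <= t -> 0 <= phi t,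
      forall s t, 0 <= s -> s <= t -> phi s <= phi t &
      phi t @[t --> +oo] --> +oo].

Definition coarse_equiv f g : Prop :=
  exists phi psi : R -> R, [/\ coarse_control phi, coarse_control psi &
    forall t, phi (f t) <= g t <= psi (f t)].

Lemma quasi_equivP f g : (forall t, 0 <= f t) -> (forall t, 0 <= g t) ->
  quasi_equiv f g <->
  exists a b : R, [/\ 0 < a, 1 <= b &
    forall t, f t <= a + b * g t /\ g t <= a + b * f t].
Proof.
move=> f0 g0; split=> -[a [b [a0 b1 fg]]].
  have b0 : 0 < b by lra.
  exists (b * a), b; split=> [||t]; [exact: mulr_gt0|by []|].
  have /andP[fg1 fg2] := fg t.
  have : b * (- a + b^-1 * f t) <= b * g t by rewrite ler_pM2l.
  rewrite mulrDr mulrA divff ?gt_eqF// mul1r => fg3; split; first by lra.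
  have : 1 * a <= b * a by rewrite ler_pM2r.
  by lra.
have b0 : 0 < b by lra.
exists a, b; split=> // t; have [fg1 fg2] := fg t; rewrite fg2 andbT.
have : b^-1 * f t <= b^-1 * (a + b * g t) by rewrite ler_pM2l// invr_gt0.
rewrite mulrDr mulrA mulVf ?gt_eqF// mul1r => fg3.
have : b^-1 * a <= 1 * a by rewrite ler_pM2r// invf_le1.
by lra.
Qed.

Lemma quasi_equiv_refl f : quasi_equiv f f.
Proof.
exists 1, 1; split=> // t; rewrite invr1 mul1r.
by apply/andP; split; lra.
Qed.

Lemma quasi_equiv_sym f g : (forall t, 0 <= f t) -> (forall t, 0 <= g t) ->
  quasi_equiv f g -> quasi_equiv g f.
Proof.
move=> f0 g0 /quasi_equivP -/(_ f0 g0) [a [b [a0 b1 fg]]].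
by apply/quasi_equivP => //; exists a, b; split=> // t; have [] := fg t.
Qed.

Lemma quasi_equiv_trans f g h : (forall t, 0 <= f t) -> (forall t, 0 <= g t) ->
  (forall t, 0 <= h t) ->
  quasi_equiv f g -> quasi_equiv g h -> quasi_equiv f h.
Proof.
move=> f0 g0 h0 /quasi_equivP -/(_ f0 g0) [a [b [a0 b1 fg]]].
move=> /quasi_equivP -/(_ g0 h0) [c [e [c0 e1 gh]]].
have b0 : 0 < b by lra. have e0 : 0 < e by lra.
apply/quasi_equivP => //; exists (a + c + b * c + e * a), (b * e).
have bc : 0 < b * c by exact: mulr_gt0.
have ea : 0 < e * a by exact: mulr_gt0.
split=> [||t]; [by lra| by rewrite -[leLHS]mulr1 ler_pM|].
have [fg1 fg2] := fg t; have [gh1 gh2] := gh t; split.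
  have : b * g t <= b * (c + e * h t) by rewrite ler_pM2l.
  by rewrite mulrDr mulrA; lra.
have : e * g t <= e * (a + b * f t) by rewrite ler_pM2l.
by rewrite mulrDr mulrA (mulrC e b); lra.
Qed.

Lemma coarse_control_large phi : coarse_control phi ->
  forall A : R, exists2 t, 0 <= t & A <= phi t.
Proof.
move=> [_ _ /cvgryPge phioo] A.
have : \forall t \near +oo, 0 <= t /\ A <= phi t.
  by near=> t; split; near: t; [exact: nbhs_pinfty_ge|exact: phioo].
by move=> /filter_ex [t [t0 At]]; exists t.
Unshelve. all: by end_near. Qed.

Lemma coarse_controlP phi : (forall t, 0 <= t -> 0 <= phi t) ->
  (forall s t, 0 <= s -> s <= t -> phi s <= phi t) ->
  (forall A : R, exists2 t, 0 <= t & A <= phi t) -> coarse_control phi.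
Proof.
move=> p0 pm pl; split=> //; apply/cvgryPge => A.
have [s s0 As] := pl A.
near=> t; apply: (le_trans As); apply: pm => //.
Unshelve. all: by end_near. Qed.

Lemma coarse_upper psi f g : coarse_control psi ->
  (forall t, 0 <= f t) -> (forall t, 0 <= g t) ->
  (forall t, f t <= psi (g t)) ->
  exists2 phi, coarse_control phi & forall t, phi (f t) <= g t.
Proof.
move=> psiC f0 g0 fg; have [p0 pm _] := psiC.
have pl := coarse_control_large psiC.
pose D s := [set t : R | 0 <= t /\ s <= psi t].
have Dn s : D s !=set0 by have [t t0 st] := pl s; exists t.
have Dlb s : has_lbound (D s) by exists 0 => t [].
exists (fun s => inf (D s)).
  apply: coarse_controlP => [s _|s t s0 st|A].
  - by apply: lb_le_inf => // t [].
  - apply: lb_le_inf => // u [u0 tu]; apply: ge_inf => //.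
    by split=> //; exact: le_trans tu.
  - exists (psi `|A| + 1); first by have := p0 `|A| (normr_ge0 _); lra.
    apply: lb_le_inf => // u [u0 pu]; rewrite leNgt; apply/negP => uA.
    have uA' : u <= `|A| by rewrite (le_trans (ltW uA))// ler_norm.
    by have := pm _ _ u0 uA'; lra.
by move=> t; apply: ge_inf => //; split.
Qed.

Lemma coarse_lower phi f g : coarse_control phi ->
  (forall t, 0 <= f t) -> (forall t, 0 <= g t) ->
  (forall t, phi (f t) <= g t) ->
  exists2 psi, coarse_control psi & forall t, f t <= psi (g t).
Proof.
move=> phiC f0 g0 fg; have [p0 pm _] := phiC.
have pl := coarse_control_large phiC.
pose D s := [set t : R | t = 0 \/ (0 <= t /\ phi t <= s)].
have D0 s : D s 0 by left.
have Dub s : has_ubound (D s).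
  have [u u0 su] := pl (s + 1); exists u => t [->//|[t0 ts]].
  rewrite leNgt; apply/negP => ut.
  by have := pm _ _ u0 (ltW ut); lra.
have Dle s t : D s t -> t <= sup (D s) by move=> Dst; exact: ub_le_sup.
exists (fun s => sup (D s)).
  apply: coarse_controlP => [s _|s t s0 st|A].
  - exact: Dle.
  - apply: sup_le_ub; first by exists 0.
    move=> u [->|[u0 us]]; apply: Dle; first by left.
    by right; split=> //; exact: le_trans st.
  - exists (phi `|A|); first exact: p0.
    by rewrite (le_trans (ler_norm A))//; apply: Dle; right.
by move=> t; apply: Dle; right.
Qed.

Lemma coarse_equivP f g : (forall t, 0 <= f t) -> (forall t, 0 <= g t) ->
  coarse_equiv f g <->
  exists psi1 psi2 : R -> R, [/\ coarse_control psi1, coarse_control psi2 &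
    forall t, f t <= psi1 (g t) /\ g t <= psi2 (f t)].
Proof.
move=> f0 g0; split=> -[p [q [pC qC fg]]].
  have [t|r rC fr] := coarse_lower pC f0 g0; first by have /andP[] := fg t.
  by exists r, q; split=> // t; split=> //; have /andP[] := fg t.
have [t|r rC fr] := coarse_upper pC f0 g0; first by have [] := fg t.
by exists r, q; split=> // t; rewrite fr; have [_ ->] := fg t.
Qed.

Lemma coarse_control_id : coarse_control id.
Proof. by apply: coarse_controlP => // A; exists `|A|; rewrite ?ler_norm. Qed.

Lemma coarse_control_comp p q : coarse_control p -> coarse_control q ->
  coarse_control (p \o q).
Proof.
move=> pC qC; have [p0 pm _] := pC; have [q0 qm _] := qC.
apply: coarse_controlP => [t t0|s t s0 st|A] /=; first by rewrite p0 ?q0.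
  by rewrite pm ?q0 ?qm.
have [t t0 At] := coarse_control_large pC A.
have [u u0 tu] := coarse_control_large qC t.
by exists u => //; rewrite (le_trans At)// pm.
Qed.

Lemma coarse_control_add p q : coarse_control p -> coarse_control q ->
  coarse_control (fun t => p t + q t).
Proof.
move=> pC [q0 qm _]; have [p0 pm _] := pC.
apply: coarse_controlP => [t t0|s t s0 st|A]; first by rewrite addr_ge0 ?p0 ?q0.
  by rewrite lerD ?pm ?qm.
have [t t0 At] := coarse_control_large pC A.
by exists t => //; have := q0 _ t0; lra.
Qed.

Lemma coarse_control_shift (c : R) : 0 <= c -> coarse_control (fun t => t + c).
Proof.
move=> c0; apply: coarse_controlP => [t t0|s t s0 st|A]; [by lra|by lra|].
by exists `|A| => //; have := ler_norm A; lra.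
Qed.

Lemma coarse_equiv_refl f : coarse_equiv f f.
Proof. by exists id, id; split=> [||t]; rewrite ?lexx//; exact: coarse_control_id. Qed.

Lemma coarse_equiv_sym f g : (forall t, 0 <= f t) -> (forall t, 0 <= g t) ->
  coarse_equiv f g -> coarse_equiv g f.
Proof.
move=> f0 g0 /coarse_equivP -/(_ f0 g0) [p [q [pC qC fg]]].
by apply/coarse_equivP => //; exists q, p; split=> // t; have [] := fg t.
Qed.

Lemma coarse_equiv_trans f g h : (forall t, 0 <= f t) -> (forall t, 0 <= g t) ->
  (forall t, 0 <= h t) ->
  coarse_equiv f g -> coarse_equiv g h -> coarse_equiv f h.
Proof.
move=> f0 g0 h0 [p [q [pC qC fg]]] [r [s [rC sC gh]]].
have [_ rm _] := rC; have [_ sm _] := sC; have [p0 _ _] := pC.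
exists (r \o p), (s \o q); split; [exact: coarse_control_comp..|].
move=> t /=; have /andP[fg1 fg2] := fg t; have /andP[gh1 gh2] := gh t.
rewrite (le_trans _ gh1) ?rm ?p0//= (le_trans gh2)//.
by apply: sm.
Qed.

End Equivalences.

Section Metrics.
Context {R : realType}.

Definition is_metric (T : Type) (d : T -> T -> R) : Prop :=
  [/\ forall x y, 0 <= d x y,
      forall x y, d x y = 0 <-> x = y,
      forall x y, d x y = d y x &
      forall x y z, d x z <= d x y + d y z].

Context (X : metricType R).

(* The point x of the first copy of X is (x, false), the point x' of the second
   copy is (x, true). *)
Definition copies_dist (d : X * bool -> X * bool -> R) : \bar R :=
  ereal_inf (range (fun p : X * X => (d (p.1, false) (p.2, true))%:E)).

(* The set of metrics on the double of X.  The distance between the copies is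
   an extended real so that it is +oo, hence nonzero, when X is empty. *)
Record doubleMetric := DoubleMetric {
  dm_fun :> X * bool -> X * bool -> R ;
  dm_metric : is_metric dm_fun ;
  dm_copy : forall (i : bool) (x y : X), dm_fun (x, i) (y, i) = mdist x y ;
  dm_copies_dist : copies_dist dm_fun <> 0%E
}.

HB.instance Definition _ := gen_eqMixin doubleMetric.
HB.instance Definition _ := gen_choiceMixin doubleMetric.

Definition cross (d : doubleMetric) (p : X * X) : R := d (p.1, false) (p.2, true).

Lemma cross_ge0 (d : doubleMetric) p : 0 <= cross d p.
Proof. by have [d0 _ _ _] := dm_metric d; exact: d0. Qed.

Lemma copies_dist_gt0 (d : doubleMetric) :
  exists2 e : R, 0 < e & forall x y, e <= d (x, false) (y, true).
Proof.
have [d0 _ _ _] := dm_metric d.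
have cd0 : (0 <= copies_dist d)%E.
  by apply: le_ereal_inf_tmp => _ [p _ <-]; rewrite lee_fin.
have cdle x y : (copies_dist d <= (d (x, false) (y, true))%:E)%E.
  by apply: ereal_inf_lbound; exists (x, y).
have := @dm_copies_dist d; move: cd0 cdle.
case: (copies_dist d) => [r| |] r0 rle rN0.
- exists r => [|x y]; last by rewrite -lee_fin.
  rewrite lt_neqAle -lee_fin r0 andbT eq_sym; apply/eqP => r00.
  by rewrite r00 in rN0.
- by exists 1 => // x y; have := rle x y; rewrite leye_eq.
- by [].
Qed.

(* The function on the double of X which is mdist on each copy and h between
   the copies. *)
Definition glue (h : X -> X -> R) (p q : X * bool) : R :=
  match p.2, q.2 with
  | false, true => h p.1 q.1
  | true, false => h q.1 p.1
  | _, _ => mdist p.1 q.1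
  end.

Section Glue.
Variables (h : X -> X -> R) (e : R).
Hypotheses (e0 : 0 < e) (eh : forall x y, e <= h x y).
Hypothesis hl : forall x u y, h x y <= mdist x u + h u y.
Hypothesis hr : forall x y v, h x y <= h x v + mdist v y.
Hypothesis ml : forall x u y, mdist x u <= h x y + h u y.
Hypothesis mr : forall x y v, mdist y v <= h x y + h x v.

Lemma glue_metric : is_metric (glue h).
Proof.
have h0 x y : 0 < h x y by exact: lt_le_trans (eh x y).
split.
- by move=> [x []] [y []] /=; rewrite /glue/= ?mdist_ge0// ltW.
- move=> [x i] [y j]; split=> [|[-> ->]]; last by case: j; exact: mdistxx.
  case: i; case: j; rewrite /glue/= => h00.
  - by rewrite (mdist_positivity _ _ h00).
  - by have := h0 y x; rewrite h00 ltxx.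
  - by have := h0 x y; rewrite h00 ltxx.
  - by rewrite (mdist_positivity _ _ h00).
- by move=> [x []] [y []]; rewrite /glue//= metric_sym.
- move=> [x []] [y []] [z []]; rewrite /glue/=.
  + exact: metric_triangle.
  + by have := hr z x y; rewrite (metric_sym y x) addrC.
  + exact: mr.
  + by have := hl z y x; rewrite (metric_sym z y) addrC.
  + exact: hr.
  + exact: ml.
  + exact: hl.
  + exact: metric_triangle.
Qed.

Lemma glue_copies_dist : copies_dist (glue h) <> 0%E.
Proof.
have ele : (e%:E <= copies_dist (glue h))%E.
  by apply: le_ereal_inf_tmp => _ [p _ <-]; rewrite lee_fin /glue/=.
by move=> c0; move: ele; rewrite c0 lee_fin leNgt e0.
Qed.

Lemma glue_copy (i : bool) x y : glue h (x, i) (y, i) = mdist x y.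
Proof. by case: i. Qed.

End Glue.

Section DoubleMetricTheory.
Implicit Type d : doubleMetric.

Lemma dm_left d x u y : d (x, false) (y, true) <= mdist x u + d (u, false) (y, true).
Proof. by have [_ _ _ dt] := dm_metric d; rewrite -(dm_copy d false). Qed.

Lemma dm_right d x y v : d (x, false) (y, true) <= d (x, false) (v, true) + mdist v y.
Proof. by have [_ _ _ dt] := dm_metric d; rewrite -(dm_copy d true). Qed.

Lemma mdist_left d x u y :
  mdist x u <= d (x, false) (y, true) + d (u, false) (y, true).
Proof.
have [_ _ ds dt] := dm_metric d.
by rewrite -(dm_copy d false) (ds (u, false)).
Qed.

Lemma mdist_right d x y v :
  mdist y v <= d (x, false) (y, true) + d (x, false) (v, true).
Proof.
have [_ _ ds dt] := dm_metric d.
by rewrite -(dm_copy d true) (ds (x, false) (y, true)).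
Qed.

End DoubleMetricTheory.

(* The composition rho d; d is applied first. *)
Definition comp_cross (rho d : doubleMetric) (x y : X) : R :=
  inf (range (fun z => d (x, false) (z, true) + rho (z, false) (y, true))).

Section Composition.
Variables rho d : doubleMetric.

Let s x y z := d (x, false) (z, true) + rho (z, false) (y, true).

Let s0 x y z : 0 <= s x y z.
Proof. exact: addr_ge0 (cross_ge0 d (x, z)) (cross_ge0 rho (z, y)). Qed.

Lemma comp_cross_le x y z :
  comp_cross rho d x y <= d (x, false) (z, true) + rho (z, false) (y, true).
Proof. exact: (@inf_range_le _ _ (s x y)). Qed.

Lemma comp_cross_adherent x y (e : R) : 0 < e ->
  exists z, d (x, false) (z, true) + rho (z, false) (y, true)
            < comp_cross rho d x y + e.
Proof. exact: (@inf_range_adherent _ _ (s x y) x). Qed.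

Lemma comp_cross_ge : exists2 e, 0 < e & forall x y, e <= comp_cross rho d x y.
Proof.
have [e e0 ed] := copies_dist_gt0 d; exists e => // x y.
apply: (le_inf_range x) => z.
by have := ed x z; have := cross_ge0 rho (z, y); rewrite /cross/=; lra.
Qed.

Lemma comp_cross_left x u y :
  comp_cross rho d x y <= mdist x u + comp_cross rho d u y.
Proof.
apply/ler_addgt0Pr => e e0; have [z uz] := comp_cross_adherent u y e0.
by have := comp_cross_le x y z; have := dm_left d x u z; lra.
Qed.

Lemma comp_cross_right x y v :
  comp_cross rho d x y <= comp_cross rho d x v + mdist v y.
Proof.
apply/ler_addgt0Pr => e e0; have [z uz] := comp_cross_adherent x v e0.
by have := comp_cross_le x y z; have := dm_right rho z y v; lra.
Qed.

Lemma mdist_comp_cross_left x u y :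
  mdist x u <= comp_cross rho d x y + comp_cross rho d u y.
Proof.
apply/ler_addgt0Pr => e e0; have e20 : 0 < e / 2 by lra.
have [z xz] := comp_cross_adherent x y e20.
have [w uw] := comp_cross_adherent u y e20.
have := mdist_left rho z w y; have := dm_right d x w z.
by have := mdist_left d x u w; lra.
Qed.

Lemma mdist_comp_cross_right x y v :
  mdist y v <= comp_cross rho d x y + comp_cross rho d x v.
Proof.
apply/ler_addgt0Pr => e e0; have e20 : 0 < e / 2 by lra.
have [z xz] := comp_cross_adherent x y e20.
have [w uw] := comp_cross_adherent x v e20.
have := mdist_right d x z w; have := dm_left rho z w v.
by have := mdist_right rho z y v; lra.
Qed.

Lemma comp_metric : is_metric (glue (comp_cross rho d)).
Proof.
have [e e0 ce] := comp_cross_ge.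
exact: (glue_metric e0 ce comp_cross_left comp_cross_right
         mdist_comp_cross_left mdist_comp_cross_right).
Qed.

Lemma comp_copies_dist : copies_dist (glue (comp_cross rho d)) <> 0%E.
Proof. by have [e e0 ce] := comp_cross_ge; exact: (glue_copies_dist e0 ce). Qed.

Definition dm_comp : doubleMetric :=
  DoubleMetric comp_metric (glue_copy _) comp_copies_dist.

End Composition.

Section QuasiClasses.
Implicit Types d rho : doubleMetric.

Definition dm_quasi d1 d2 : bool := `[< quasi_equiv (cross d1) (cross d2) >].

Let dm_quasi_refl : reflexive dm_quasi.
Proof. by move=> d; apply/asboolP/quasi_equiv_refl. Qed.

Let dm_quasi_sym : symmetric dm_quasi.
Proof.
by move=> d e; apply/asboolP/asboolP; apply: quasi_equiv_sym; exact: cross_ge0.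
Qed.

Let dm_quasi_trans : transitive dm_quasi.
Proof.
move=> e d f /asboolP de /asboolP ef; apply/asboolP.
by apply: quasi_equiv_trans de ef; exact: cross_ge0.
Qed.

Canonical dm_quasi_equiv :=
  EquivRel dm_quasi dm_quasi_refl dm_quasi_sym dm_quasi_trans.

Definition Mq : Type := {eq_quot dm_quasi}.
HB.instance Definition _ := Choice.on Mq.
HB.instance Definition _ := EqQuotient.on Mq.

Lemma pi_MqP d1 d2 :
  \pi_Mq d1 = \pi_Mq d2 <-> quasi_equiv (cross d1) (cross d2).
Proof.
split=> [/eqP|de]; first by rewrite eqmodE => /asboolP.
by apply/eqP; rewrite eqmodE; exact/asboolP.
Qed.

Lemma dm_comp_quasi rho1 rho2 d1 d2 :
  quasi_equiv (cross rho1) (cross rho2) -> quasi_equiv (cross d1) (cross d2) ->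
  quasi_equiv (cross (dm_comp rho1 d1)) (cross (dm_comp rho2 d2)).
Proof.
suff H r1 r2 c1 c2 (a b a' b' : R) : 0 < a -> 0 < a' -> 1 <= b -> 1 <= b' ->
    (forall p, cross r2 p <= a + b * cross r1 p) ->
    (forall p, cross c2 p <= a' + b' * cross c1 p) ->
    forall p, cross (dm_comp r2 c2) p <=
      (a + a' + b + b') + (b + b') * cross (dm_comp r1 c1) p.
  move=> /quasi_equivP -/(_ (cross_ge0 _) (cross_ge0 _)) [a [b [a0 b1 rr]]].
  move=> /quasi_equivP -/(_ (cross_ge0 _) (cross_ge0 _)) [a' [b' [a'0 b'1 dd]]].
  apply/quasi_equivP; [exact: cross_ge0..|].
  exists (a + a' + b + b'), (b + b'); split; [by lra|by lra|] => p.
  by split; apply: H => // q; [have [] := rr q|have [] := dd q|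
    have [] := rr q|have [] := dd q].
move=> a0 a'0 b1 b'1 rr cc [x y]; rewrite /cross /dm_comp/= /glue/=.
have [z xz] := comp_cross_adherent r1 c1 x y ltr01.
have := comp_cross_le r2 c2 x y z.
have := rr (z, y); have := cc (x, z).
have := cross_ge0 r1 (z, y); have := cross_ge0 c1 (x, z).
rewrite /cross/= => c10 r10 cc' rr' le2.
have : (b + b') * (c1 (x, false) (z, true) + r1 (z, false) (y, true)) <=
       (b + b') * (comp_cross r1 c1 x y + 1).
  by rewrite ler_wpM2l ?ltW//; lra.
have : 0 <= b * c1 (x, false) (z, true) by apply: mulr_ge0; lra.
have : 0 <= b' * r1 (z, false) (y, true) by apply: mulr_ge0; lra.
by rewrite !mulrDl !mulrDr; lra.
Qed.

(* Independent of the representatives by [Mq_mulE]. *)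
Definition Mq_mul (a b : Mq) : Mq := \pi_Mq (dm_comp (repr a) (repr b)).

Lemma Mq_mulE rho d : Mq_mul (\pi_Mq rho) (\pi_Mq d) = \pi_Mq (dm_comp rho d).
Proof.
by apply/pi_MqP/dm_comp_quasi; apply/pi_MqP; rewrite reprK.
Qed.

Definition EMq : set Mq := [set c | Mq_mul c c = c].

End QuasiClasses.

Section CoarseClasses.
Implicit Types d rho : doubleMetric.

Definition dm_coarse d1 d2 : bool := `[< coarse_equiv (cross d1) (cross d2) >].

Let dm_coarse_refl : reflexive dm_coarse.
Proof. by move=> d; apply/asboolP/coarse_equiv_refl. Qed.

Let dm_coarse_sym : symmetric dm_coarse.
Proof.
by move=> d e; apply/asboolP/asboolP; apply: coarse_equiv_sym; exact: cross_ge0.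
Qed.

Let dm_coarse_trans : transitive dm_coarse.
Proof.
move=> e d f /asboolP de /asboolP ef; apply/asboolP.
by apply: coarse_equiv_trans de ef; exact: cross_ge0.
Qed.

Canonical dm_coarse_equiv :=
  EquivRel dm_coarse dm_coarse_refl dm_coarse_sym dm_coarse_trans.

Definition Mc : Type := {eq_quot dm_coarse}.
HB.instance Definition _ := Choice.on Mc.
HB.instance Definition _ := EqQuotient.on Mc.

Lemma pi_McP d1 d2 :
  \pi_Mc d1 = \pi_Mc d2 <-> coarse_equiv (cross d1) (cross d2).
Proof.
split=> [/eqP|de]; first by rewrite eqmodE => /asboolP.
by apply/eqP; rewrite eqmodE; exact/asboolP.
Qed.

Lemma dm_comp_coarse rho1 rho2 d1 d2 :
  coarse_equiv (cross rho1) (cross rho2) -> coarse_equiv (cross d1) (cross d2) ->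
  coarse_equiv (cross (dm_comp rho1 d1)) (cross (dm_comp rho2 d2)).
Proof.
suff H r1 r2 c1 c2 (p q : R -> R) : coarse_control p -> coarse_control q ->
    (forall t, cross r2 t <= p (cross r1 t)) ->
    (forall t, cross c2 t <= q (cross c1 t)) ->
    forall t, cross (dm_comp r2 c2) t <=
      ((fun s => p s + q s) \o (fun s => s + 1)) (cross (dm_comp r1 c1) t).
  move=> /coarse_equivP -/(_ (cross_ge0 _) (cross_ge0 _)) [p [q [pC qC rr]]].
  move=> /coarse_equivP -/(_ (cross_ge0 _) (cross_ge0 _)) [p' [q' [p'C q'C dd]]].
  apply/coarse_equivP; [exact: cross_ge0..|].
  exists ((fun s => p s + p' s) \o (fun s => s + 1)).
  exists ((fun s => q s + q' s) \o (fun s => s + 1)).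
  split; [exact: coarse_control_comp (coarse_control_add _ _)
                   (coarse_control_shift ler01)..|] => t.
  by split; apply: H => // s; [have [] := rr s|have [] := dd s|
    have [] := rr s|have [] := dd s].
move=> pC qC rr cc [x y]; rewrite /cross /dm_comp/= /glue/=.
have [_ pm _] := pC; have [_ qm _] := qC.
have [z xz] := comp_cross_adherent r1 c1 x y ltr01.
have := comp_cross_le r2 c2 x y z.
have := rr (z, y); have := cc (x, z).
have := cross_ge0 r1 (z, y); have := cross_ge0 c1 (x, z).
rewrite /cross/= => c10 r10 cc' rr' le2.
have : p (r1 (z, false) (y, true)) <= p (comp_cross r1 c1 x y + 1).
  by apply: pm => //; lra.
have : q (c1 (x, false) (z, true)) <= q (comp_cross r1 c1 x y + 1).
  by apply: qm => //; lra.
by lra.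
Qed.

(* Independent of the representatives by [Mc_mulE]. *)
Definition Mc_mul (a b : Mc) : Mc := \pi_Mc (dm_comp (repr a) (repr b)).

Lemma Mc_mulE rho d : Mc_mul (\pi_Mc rho) (\pi_Mc d) = \pi_Mc (dm_comp rho d).
Proof.
by apply/pi_McP/dm_comp_coarse; apply/pi_McP; rewrite reprK.
Qed.

Definition EMc : set Mc := [set c | Mc_mul c c = c].

End CoarseClasses.

Record Cm := CmFunction {
  cm_fun :> X -> R ;
  cm_ge0 : forall x, 0 <= cm_fun x ;
  cm_continuous : continuous cm_fun ;
  cm_bounded_below : exists2 e : R, 0 < e & forall x, e <= cm_fun x ;
  cm_lipschitz : forall x y, `|cm_fun x - cm_fun y| <= 2 * mdist x y
}.

HB.instance Definition _ := gen_eqMixin Cm.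
HB.instance Definition _ := gen_choiceMixin Cm.

Section FunctionClasses.
Implicit Types f g : Cm.

Definition cm_quasi f g : bool := `[< quasi_equiv f g >].

Let cm_quasi_refl : reflexive cm_quasi.
Proof. by move=> f; apply/asboolP/quasi_equiv_refl. Qed.

Let cm_quasi_sym : symmetric cm_quasi.
Proof.
by move=> f g; apply/asboolP/asboolP; apply: quasi_equiv_sym; exact: cm_ge0.
Qed.

Let cm_quasi_trans : transitive cm_quasi.
Proof.
move=> g f h /asboolP fg /asboolP gh; apply/asboolP.
by apply: quasi_equiv_trans fg gh; exact: cm_ge0.
Qed.

Canonical cm_quasi_equiv :=
  EquivRel cm_quasi cm_quasi_refl cm_quasi_sym cm_quasi_trans.

Definition Cmq : Type := {eq_quot cm_quasi}.
HB.instance Definition _ := Choice.on Cmq.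
HB.instance Definition _ := EqQuotient.on Cmq.

Lemma pi_CmqP f g : \pi_Cmq f = \pi_Cmq g <-> quasi_equiv f g.
Proof.
split=> [/eqP|fg]; first by rewrite eqmodE => /asboolP.
by apply/eqP; rewrite eqmodE; exact/asboolP.
Qed.

Definition cm_coarse f g : bool := `[< coarse_equiv f g >].

Let cm_coarse_refl : reflexive cm_coarse.
Proof. by move=> f; apply/asboolP/coarse_equiv_refl. Qed.

Let cm_coarse_sym : symmetric cm_coarse.
Proof.
by move=> f g; apply/asboolP/asboolP; apply: coarse_equiv_sym; exact: cm_ge0.
Qed.

Let cm_coarse_trans : transitive cm_coarse.
Proof.
move=> g f h /asboolP fg /asboolP gh; apply/asboolP.
by apply: coarse_equiv_trans fg gh; exact: cm_ge0.
Qed.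

Canonical cm_coarse_equiv :=
  EquivRel cm_coarse cm_coarse_refl cm_coarse_sym cm_coarse_trans.

Definition Cmc : Type := {eq_quot cm_coarse}.
HB.instance Definition _ := Choice.on Cmc.
HB.instance Definition _ := EqQuotient.on Cmc.

Lemma pi_CmcP f g : \pi_Cmc f = \pi_Cmc g <-> coarse_equiv f g.
Proof.
split=> [/eqP|fg]; first by rewrite eqmodE => /asboolP.
by apply/eqP; rewrite eqmodE; exact/asboolP.
Qed.

End FunctionClasses.

Lemma lipschitz2_continuous (f : X -> R) :
  (forall x y, `|f x - f y| <= 2 * mdist x y) -> continuous f.
Proof.
move=> fl x; apply/cvgrPdist_lt => e e0.
have e20 : 0 < e / 2 by lra.
have := nbhsx_ballx x _ e20; apply: filterS => y.
rewrite ballEmdist/= => xy; apply: le_lt_trans (fl x y) _.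
by lra.
Qed.

Section FMap.
Variable d : doubleMetric.

Definition Fdiag (x : X) : R := d (x, false) (x, true).

Lemma Fdiag_ge0 x : 0 <= Fdiag x.
Proof. exact: (cross_ge0 d (x, x)). Qed.

Lemma Fdiag_lipschitz x y : `|Fdiag x - Fdiag y| <= 2 * mdist x y.
Proof.
have := dm_left d x y x; have := dm_right d y x y.
have := dm_left d y x y; have := dm_right d x y x.
rewrite (metric_sym y x) /Fdiag ler_norml => *.
by apply/andP; split; lra.
Qed.

Lemma Fdiag_bounded_below : exists2 e : R, 0 < e & forall x, e <= Fdiag x.
Proof.
by have [e e0 ed] := copies_dist_gt0 d; exists e => // x; exact: ed.
Qed.

Definition Fmap : Cm :=
  CmFunction Fdiag_ge0 (lipschitz2_continuous Fdiag_lipschitz)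
    Fdiag_bounded_below Fdiag_lipschitz.

End FMap.

(* Fq and Fc are defined on all classes; the statement restricts them to the
   idempotent ones.  They do not depend on the representatives by [FqE], [FcE]. *)
Definition Fq (c : Mq) : Cmq := \pi_Cmq (Fmap (repr c)).

Lemma FqE d : Fq (\pi_Mq d) = \pi_Cmq (Fmap d).
Proof.
apply/pi_CmqP.
have /pi_MqP[a [b [a0 b1 H]]] := reprK (\pi_Mq d).
by exists a, b; split=> // x; exact: (H (x, x)).
Qed.

Definition Fc (c : Mc) : Cmc := \pi_Cmc (Fmap (repr c)).

Lemma FcE d : Fc (\pi_Mc d) = \pi_Cmc (Fmap d).
Proof.
apply/pi_CmcP.
have /pi_McP[p [q [pC qC H]]] := reprK (\pi_Mc d).
by exists p, q; split=> // x; exact: (H (x, x)).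
Qed.

End Metrics.

(* Main.v *)
Require Import Defs.
From mathcomp Require Import all_boot all_order all_algebra.
From mathcomp Require Import ring lra.
From mathcomp Require Import all_classical all_reals all_analysis.

(** Think of [d] in [M(X)] as a family of partial maps of [X], where [x] goes to
[y] at scale [c] when [d(x,y') <= c].  The triangle inequality for [d] makes
each of them well defined and injective up to an error [2c].

Injectivity.  A partial injection [e] with [e e = e] is a partial identity, and
the coarse form of this argument carries the proof.  If [x] goes to [y] and [d]
is idempotent, then [x] goes to some [z] and [z] goes to [y], at a scale
controlled by [c].  Since [x] goes to both [y] and [z], these two are close;
since both [x] and [z] go to [y], they are close as well.  Hence [y] is close to
[x], and [x] goes to itself: both [d_X(x,y)] and [d(x,x')] are controlled by
[d(x,y')] ([mdist_le_cross_comp], [Fdiag_le_cross_comp]).  Conversely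
[d(x,y') <= d(x,x') + d_X(x,y)].  So an idempotent class is determined by the
class of its diagonal ([cross_le_of_diag]).

Surjectivity.  For [f] in [C_m(X)] the formula
[d(x,y') = max (d_X(x,y), (f(x) + f(y)) / 2)] defines a metric with diagonal
[f]; condition (f2) is exactly what makes [(f(x) + f(y)) / 2] 1-Lipschitz in
each variable.  Both terms of the maximum are at most
[d(x,z') + d(z,y')] for every [z], and taking [z = x] costs a factor at most
[3], so [d <= d d <= 3 d] and the class of [d] is idempotent. *)

Set Implicit Arguments.
Unset Strict Implicit.
Unset Printing Implicit Defensive.

Import Order.TTheory GRing.Theory Num.Theory.
Local Open Scope ring_scope.
Local Open Scope quotient_scope.
Local Open Scope classical_set_scope.

(** * Control functions *)

Lemma coarse_control_affine (R : realType) (a b : R) : 0 < a -> 1 <= b ->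
  coarse_control (fun t => a + b * t).
Proof.
move=> a0 b1; apply: coarse_controlP => [t t0|s t s0 st|A].
- by rewrite addr_ge0 ?mulr_ge0//; lra.
- by rewrite lerD2l ler_wpM2l//; lra.
- exists `|A|; rewrite ?normr_ge0//.
  have A0 := normr_ge0 A; have AA := ler_norm A.
  have : 1 * `|A| <= b * `|A| by rewrite ler_wpM2r.
  by lra.
Qed.

Lemma quasi_equiv_coarse (R : realType) (T : Type) (f g : T -> R) :
  (forall t, 0 <= f t) -> (forall t, 0 <= g t) ->
  quasi_equiv f g -> coarse_equiv f g.
Proof.
move=> f0 g0 /(quasi_equivP f0 g0) [a [b [a0 b1 fg]]].
apply/(coarse_equivP f0 g0).
by exists (fun t => a + b * t), (fun t => a + b * t); split=> //;
  exact: coarse_control_affine.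
Qed.

(** * Idempotents are determined by their diagonal *)

Section Diagonal.
Context {R : realType} {X : metricType R}.
Implicit Types d e : doubleMetric X.

(** Through an intermediate point [z] of the composition: [y] and [z] are both
near the image of [x], while [x] and [z] are both near the preimage of [y]. *)
Lemma mdist_le_cross_comp d x y :
  mdist x y <= 2 * cross d (x, y) + cross (dm_comp d d) (x, y).
Proof.
apply/ler_addgt0Pr => r r0; rewrite /cross/= /Defs.glue/=.
have [z] := comp_cross_adherent d d x y r0.
have := mdist_right d x z y; have := mdist_left d x z y.
by have := metric_triangle x z y; lra.
Qed.

(** Here [x] goes to [z], and [z] is near [x] as both go to [y]. *)
Lemma Fdiag_le_cross_comp d x y :
  Fdiag d x <= cross d (x, y) + cross (dm_comp d d) (x, y).
Proof.
apply/ler_addgt0Pr => r r0; rewrite /cross/= /Defs.glue/= /Fdiag.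
have [z] := comp_cross_adherent d d x y r0.
have := mdist_left d x z y; have := dm_right d x x z.
by rewrite (metric_sym z x); lra.
Qed.

(** Going through the diagonal: [e(x,y') <= e(x,x') + d_X(x,y)], where [e(x,x')] is
bounded by [q] of [d(x,x')], and the two lemmas above bound [d(x,x')] and
[d_X(x,y)] by [d(x,y')].  The explicit bound serves both equivalences: it is
affine when [p] and [q] are, and a control function when they are. *)
Lemma cross_le_of_diag d e (p q : R -> R) :
  (forall s t, 0 <= s -> s <= t -> q s <= q t) ->
  (forall t, cross (dm_comp d d) t <= p (cross d t)) ->
  (forall x, Fdiag e x <= q (Fdiag d x)) ->
  forall t, cross e t <=
    q (cross d t + p (cross d t)) + (2 * cross d t + p (cross d t)).
Proof.
move=> qm dp eq [x y].
have := dp (x, y); have := mdist_le_cross_comp d x y.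
have := Fdiag_le_cross_comp d x y; have := eq x.
have exy : cross e (x, y) <= Fdiag e x + mdist x y by exact: dm_right.
move=> eqx dx mxy cp.
have : q (Fdiag d x) <= q (cross d (x, y) + p (cross d (x, y))).
  by apply: qm; [exact: Fdiag_ge0|lra].
by lra.
Qed.

Lemma quasi_idempotent_eq d e :
  quasi_equiv (cross (dm_comp d d)) (cross d) ->
  quasi_equiv (cross (dm_comp e e)) (cross e) ->
  quasi_equiv (Fmap d) (Fmap e) -> quasi_equiv (cross d) (cross e).
Proof.
have bound d' e' (a b a' b' : R) : 0 < a -> 1 <= b -> 0 < a' -> 1 <= b' ->
    (forall t, cross (dm_comp d' d') t <= a + b * cross d' t) ->
    (forall x, Fdiag e' x <= a' + b' * Fdiag d' x) ->
    forall t, cross e' t <=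
      (a' + b' * a + a) + (b' + b' * b + 2 + b) * cross d' t.
  move=> a0 b1 a'0 b'1 da ea t; apply: le_trans.
    apply: (@cross_le_of_diag d' e' (fun s => a + b * s) (fun s => a' + b' * s))
      => // s u s0 su.
    by rewrite lerD2l ler_wpM2l//; lra.
  by rewrite le_eqVlt; apply/orP; left; apply/eqP; ring.
move=> /(quasi_equivP (cross_ge0 _) (cross_ge0 _)) [a [b [a0 b1 dd]]].
move=> /(quasi_equivP (cross_ge0 _) (cross_ge0 _)) [a' [b' [a'0 b'1 ee]]].
move=> /(quasi_equivP (Fdiag_ge0 _) (Fdiag_ge0 _)) [c [g [c0 g1 de]]].
apply/quasi_equivP; [exact: cross_ge0..|].
have pos r s : 0 < r -> 1 <= s -> 0 < s * r :> R.
  by move=> r0 s1; apply: mulr_gt0 => //; lra.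
have ga := pos a g a0 g1; have ga' := pos a' g a'0 g1.
have gb : 0 < g * b by apply: pos => //; lra.
have gb' : 0 < g * b' by apply: pos => //; lra.
(* The constants of the two one-sided bounds, added up to serve for both. *)
exists ((c + g * a + a) + (c + g * a' + a')).
exists ((g + g * b + 2 + b) + (g + g * b' + 2 + b')).
split; [by lra|by lra|] => t; split.
- have := bound e d _ _ _ _ a'0 b'1 c0 g1
    (fun t => proj1 (ee t)) (fun x => proj1 (de x)) t.
  have : 0 <= (g + g * b + 2 + b) * cross e t.
    by apply: mulr_ge0 (cross_ge0 e t); lra.
  by rewrite (mulrDl (g + g * b + 2 + b)); lra.
- have := bound d e _ _ _ _ a0 b1 c0 g1
    (fun t => proj1 (dd t)) (fun x => proj2 (de x)) t.
  have : 0 <= (g + g * b' + 2 + b') * cross d t.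
    by apply: mulr_ge0 (cross_ge0 d t); lra.
  by rewrite (mulrDl (g + g * b + 2 + b)); lra.
Qed.

Lemma coarse_idempotent_eq d e :
  coarse_equiv (cross (dm_comp d d)) (cross d) ->
  coarse_equiv (cross (dm_comp e e)) (cross e) ->
  coarse_equiv (Fmap d) (Fmap e) -> coarse_equiv (cross d) (cross e).
Proof.
have ctl (p q : R -> R) : coarse_control p -> coarse_control q ->
    coarse_control (fun t => q (t + p t) + (2 * t + p t)).
  move=> pC qC; have idC := @coarse_control_id R.
  have -> : (fun t => q (t + p t) + (2 * t + p t)) =
            (fun t => (q \o (fun t => t + p t)) t + (t + (t + p t))).
    by apply/funext => t /=; lra.
  have idpC := coarse_control_add idC pC.
  exact: coarse_control_add (coarse_control_comp qC idpC)
    (coarse_control_add idC idpC).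
move=> /(coarse_equivP (cross_ge0 _) (cross_ge0 _)) [p [? [pC _ dd]]].
move=> /(coarse_equivP (cross_ge0 _) (cross_ge0 _)) [p' [? [p'C _ ee]]].
move=> /(coarse_equivP (Fdiag_ge0 _) (Fdiag_ge0 _)) [q [q' [qC q'C de]]].
apply/coarse_equivP; [exact: cross_ge0..|].
exists (fun t => q (t + p' t) + (2 * t + p' t)).
exists (fun t => q' (t + p t) + (2 * t + p t)).
split; [exact: ctl..|] => t; split.
- have [_ qm _] := qC; apply: (cross_le_of_diag qm) => [s|x].
    by have [] := ee s.
  by have [] := de x.
- have [_ qm _] := q'C; apply: (cross_le_of_diag qm) => [s|x].
    by have [] := dd s.
  by have [] := de x.
Qed.

End Diagonal.

(** * An idempotent with prescribed diagonal *)

Section PrescribedDiagonal.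
Context {R : realType} {X : metricType R}.
Variable f : Cm X.

(** An idempotent controls both [d_X(x,y)] and its diagonal, so these two have to
enter the formula.  They enter through a maximum rather than a sum: a sum would
only be 2-Lipschitz in each variable, and the triangle inequality would fail. *)
Definition diag_cross (x y : X) : R := Num.max (mdist x y) ((f x + f y) / 2).

Let cm_lip x y : f x <= f y + 2 * mdist x y.
Proof. by have := cm_lipschitz f x y; rewrite ler_norml => /andP[_]; lra. Qed.

Let le_diag_cross x y :
  mdist x y <= diag_cross x y /\ (f x + f y) / 2 <= diag_cross x y.
Proof. by rewrite /diag_cross !le_max !lexx orbT. Qed.

Lemma diag_cross_bounded_below :
  exists2 r, 0 < r & forall x y, r <= diag_cross x y.
Proof.
have [r r0 rf] := cm_bounded_below f; exists r => // x y.
by have [_] := le_diag_cross x y; have := rf x; have := rf y; lra.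
Qed.

Lemma diag_cross_left x u y : diag_cross x y <= mdist x u + diag_cross u y.
Proof.
have [] := le_diag_cross u y; have := metric_triangle x u y.
have := cm_lip x u.
by rewrite {3}/diag_cross ge_max => *; apply/andP; split; lra.
Qed.

Lemma diag_cross_right x y v : diag_cross x y <= diag_cross x v + mdist v y.
Proof.
have [] := le_diag_cross x v; have := metric_triangle x v y.
have := cm_lip y v; rewrite (metric_sym y v).
by rewrite {3}/diag_cross ge_max => *; apply/andP; split; lra.
Qed.

Lemma mdist_diag_cross_left x u y :
  mdist x u <= diag_cross x y + diag_cross u y.
Proof.
have [? _] := le_diag_cross x y; have [+ _] := le_diag_cross u y.
by have := metric_triangle x y u; rewrite (metric_sym y u); lra.
Qed.

Lemma mdist_diag_cross_right x y v :
  mdist y v <= diag_cross x y + diag_cross x v.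
Proof.
have [? _] := le_diag_cross x y; have [+ _] := le_diag_cross x v.
by have := metric_triangle y x v; rewrite (metric_sym y x); lra.
Qed.

Lemma diag_metric : is_metric (Defs.glue diag_cross).
Proof.
have [r r0 rd] := diag_cross_bounded_below.
exact: (glue_metric r0 rd diag_cross_left diag_cross_right
         mdist_diag_cross_left mdist_diag_cross_right).
Qed.

Lemma diag_copies_dist : copies_dist (Defs.glue diag_cross) <> 0%E.
Proof.
by have [r r0 rd] := diag_cross_bounded_below; exact: (glue_copies_dist r0 rd).
Qed.

Definition dm_diag : doubleMetric X :=
  DoubleMetric diag_metric (glue_copy _) diag_copies_dist.

Lemma Fdiag_dm_diag x : Fdiag dm_diag x = f x.
Proof.
rewrite /Fdiag/= /Defs.glue/= /diag_cross mdistxx -[RHS](_ : (f x + f x) / 2 = _).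
  by apply/max_idPr; have := cm_ge0 f x; lra.
by lra.
Qed.

(** Both terms of the maximum are subadditive along [x], [z], [y], which gives
[d <= d d]; the point [z = x] gives [d d <= f(x) + d] with [f <= 2 d]. *)
Lemma dm_diag_idempotent :
  quasi_equiv (cross (dm_comp dm_diag dm_diag)) (cross dm_diag).
Proof.
apply/quasi_equivP; [exact: cross_ge0..|].
exists 1, 3; split; [by lra|by lra|] => -[x y].
have dd0 := cross_ge0 (dm_comp dm_diag dm_diag) (x, y).
have := comp_cross_le dm_diag dm_diag x y x.
rewrite -/(Fdiag dm_diag x) Fdiag_dm_diag.
have fy := cm_ge0 f y; have [dxy fxy] := le_diag_cross x y.
have : diag_cross x y <= comp_cross dm_diag dm_diag x y.
  apply: (le_inf_range x) => z; rewrite /= /Defs.glue/=.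
  have [dxz fxz] := le_diag_cross x z; have [dzy fzy] := le_diag_cross z y.
  have fz := cm_ge0 f z; have := metric_triangle x z y.
  by rewrite {1}/diag_cross ge_max => ?; apply/andP; split; lra.
by move: dd0; rewrite /cross/= /Defs.glue/=; lra.
Qed.

End PrescribedDiagonal.

(** * The bijections *)

Theorem theorem4p4 (R : realType) (X : metricType R) :
  set_bij (@EMq R X) [set: Cmq X] (@Fq R X) /\
  set_bij (@EMc R X) [set: Cmc X] (@Fc R X).
Proof.
split; split=> //.
- move=> c1 c2 /set_mem + /set_mem; rewrite -(reprK c1) -(reprK c2) /EMq/=.
  rewrite !Mq_mulE => /pi_MqP dd /pi_MqP ee.
  by rewrite !FqE => /pi_CmqP de; apply/pi_MqP; exact: quasi_idempotent_eq.
- move=> c _; exists (\pi_(Mq X) (dm_diag (repr c))).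
    by rewrite /EMq/= Mq_mulE; apply/pi_MqP; exact: dm_diag_idempotent.
  rewrite FqE -[RHS]reprK; apply/pi_CmqP.
  have -> : Fmap (dm_diag (repr c)) = repr c :> (X -> R).
    by apply/funext; exact: Fdiag_dm_diag.
  exact: quasi_equiv_refl.
- move=> c1 c2 /set_mem + /set_mem; rewrite -(reprK c1) -(reprK c2) /EMc/=.
  rewrite !Mc_mulE => /pi_McP dd /pi_McP ee.
  by rewrite !FcE => /pi_CmcP de; apply/pi_McP; exact: coarse_idempotent_eq.
- move=> c _; exists (\pi_(Mc X) (dm_diag (repr c))).
    rewrite /EMc/= Mc_mulE; apply/pi_McP.
    by apply: quasi_equiv_coarse (dm_diag_idempotent _); exact: cross_ge0.
  rewrite FcE -[RHS]reprK; apply/pi_CmcP.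
  have -> : Fmap (dm_diag (repr c)) = repr c :> (X -> R).
    by apply/funext; exact: Fdiag_dm_diag.
  exact: coarse_equiv_refl.
Qed.
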